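(* Let $X$ be a compact metric space, let $I$ be an uncountable set, and for every $\alpha \in I$ let $G_{\alpha}$ be a non-Abelian group. Then the direct sum $\bigoplus_{\alpha \in I} G_{\alpha}$ does not embed into the group $\mathrm{Homeo}(X)$ of homeomorphisms of $X$; that is, there is no injective group homomorphism $\bigoplus_{\alpha \in I} G_{\alpha} \to \mathrm{Homeo}(X)$.
   Context: $\mathrm{Homeo}(X)$ denotes the group of all homeomorphisms $X \to X$ under composition. The direct sum $\bigoplus_{\alpha\in I} G_\alpha$ is the subgroup of the direct product $\prod_{\alpha \in I} G_\alpha$ consisting of the families $(g_\alpha)_{\alpha\in I}$ with $g_\alpha = 1$ for all but finitely many $\alpha$. ''Embeds'' means embeds as an abstract group (no continuity is required). *)

(* Defs.v *)
From HB Require Import structures.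
From mathcomp Require Import all_boot.
From mathcomp Require Import boolp classical_sets functions cardinality.
From mathcomp Require Import reals topology.

Set Implicit Arguments.
Unset Strict Implicit.
Unset Printing Implicit Defensive.

Local Open Scope classical_set_scope.
Local Open Scope group_scope.

Definition direct_product (I : Type) (G : I -> groupType) : Type :=
  forall i, G i.

Section DirectProduct.
Variables (I : Type) (G : I -> groupType).
Implicit Types f g h : direct_product G.

HB.instance Definition _ := Choice.copy (direct_product G) (forall i, G i).

Definition direct_product_one : direct_product G := fun=> 1.
Definition direct_product_inv f : direct_product G := fun i => (f i)^-1.
Definition direct_product_mul f g : direct_product G := fun i => f i * g i.

Lemma direct_product_mulA : associative direct_product_mul.
Proof. by move=> f g h; apply: functional_extensionality_dep => i; exact: mulgA. Qed.

Lemma direct_product_mul1 : left_id direct_product_one direct_product_mul.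
Proof. by move=> f; apply: functional_extensionality_dep => i; exact: mul1g. Qed.

Lemma direct_product_mulr1 : right_id direct_product_one direct_product_mul.
Proof. by move=> f; apply: functional_extensionality_dep => i; exact: mulg1. Qed.

Lemma direct_product_mulV :
  left_inverse direct_product_one direct_product_inv direct_product_mul.
Proof. by move=> f; apply: functional_extensionality_dep => i; exact: mulVg. Qed.

Lemma direct_product_mulrV :
  right_inverse direct_product_one direct_product_inv direct_product_mul.
Proof. by move=> f; apply: functional_extensionality_dep => i; exact: mulgV. Qed.

HB.instance Definition _ := isGroup.Build (direct_product G)
  direct_product_mulA direct_product_mul1 direct_product_mulr1
  direct_product_mulV direct_product_mulrV.

Definition finitely_supported : pred (direct_product G) :=
  fun f => `[< finite_set [set i | f i <> 1] >].

Lemma finitely_supported_group_closed : group_closed finitely_supported.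
Proof.
split=> [|f g /asboolP ff /asboolP gf]; apply/asboolP.
  by apply: (sub_finite_set _ (finite_set0 I)) => i /=.
have /sub_finite_set : [set i | (f / g) i <> 1] `<=`
    [set i | f i <> 1] `|` [set i | g i <> 1].
  move=> i /= fgi.
  have [fi|] := pselect (f i = 1); last by left.
  right=> gi; apply: fgi; change (f i * (g i)^-1 = 1).
  by rewrite fi gi mulgV.
by apply; rewrite finite_setU.
Qed.

Record direct_sum := DirectSum {
  direct_sum_val : direct_product G;
  direct_sumP : finitely_supported direct_sum_val }.

HB.instance Definition _ := [isSub for direct_sum_val].
HB.instance Definition _ := [Choice of direct_sum by <:].
HB.instance Definition _ := SubChoice_isSubGroup.Build
  (direct_product G) finitely_supported direct_sum
  finitely_supported_group_closed.

End DirectProduct.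

Record homeo (X : topologicalType) := Homeo {
  homeo_fun :> X -> X;
  homeo_inv : X -> X;
  homeo_funK : cancel homeo_fun homeo_inv;
  homeo_invK : cancel homeo_inv homeo_fun;
  homeo_fun_continuous : continuous homeo_fun;
  homeo_inv_continuous : continuous homeo_inv }.

Section HomeoGroup.
Variable X : topologicalType.
Implicit Types f g h : homeo X.

(* The inverse stored in a [homeo] is determined by the map itself. *)
Lemma homeo_eqP f g : f =1 g -> f = g.
Proof.
case: f g => [f f' fK f'K fc f'c] [g g' gK g'K gc g'c] /= /funext efg.
subst g.
have e : f' = g' by apply/funext => x; rewrite -[in LHS](g'K x) fK.
subst g'; f_equal; exact: Prop_irrelevance.
Qed.

HB.instance Definition _ := gen_eqMixin (homeo X).
HB.instance Definition _ := gen_choiceMixin (homeo X).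

Definition homeo_id : homeo X :=
  @Homeo X id id (fun=> erefl) (fun=> erefl)
    (fun=> cvg_id) (fun=> cvg_id).

Definition homeo_sym f : homeo X :=
  Homeo (@homeo_invK X f) (@homeo_funK X f)
    (@homeo_inv_continuous X f) (@homeo_fun_continuous X f).

Definition homeo_comp f g : homeo X :=
  @Homeo X (f \o g) (homeo_inv g \o homeo_inv f)
    (can_comp (@homeo_funK X f) (@homeo_funK X g))
    (can_comp (@homeo_invK X g) (@homeo_invK X f))
    (fun x => continuous_comp (@homeo_fun_continuous X g x)
                              (@homeo_fun_continuous X f (g x)))
    (fun x => continuous_comp (@homeo_inv_continuous X f x)
                (@homeo_inv_continuous X g (homeo_inv f x))).

Lemma homeo_compA : associative homeo_comp.
Proof. by move=> f g h; apply: homeo_eqP. Qed.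

Lemma homeo_comp1 : left_id homeo_id homeo_comp.
Proof. by move=> f; apply: homeo_eqP. Qed.

Lemma homeo_compr1 : right_id homeo_id homeo_comp.
Proof. by move=> f; apply: homeo_eqP. Qed.

Lemma homeo_compV : left_inverse homeo_id homeo_sym homeo_comp.
Proof. by move=> f; apply: homeo_eqP => x; exact: homeo_funK. Qed.

Lemma homeo_comprV : right_inverse homeo_id homeo_sym homeo_comp.
Proof. by move=> f; apply: homeo_eqP => x; exact: homeo_invK. Qed.

HB.instance Definition _ := isGroup.Build (homeo X)
  homeo_compA homeo_comp1 homeo_compr1 homeo_compV homeo_comprV.

End HomeoGroup.

(* Main.v *)
Require Import Defs.
From HB Require Import structures.
From mathcomp Require Import all_boot.
From mathcomp Require Import boolp classical_sets functions cardinality.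
From mathcomp Require Import reals topology.

Local Open Scope classical_set_scope.
Local Open Scope group_scope.

(** Choose non-commuting elements [x i], [y i] in every factor. Placed in their
    own coordinates and mapped to homeomorphisms, they give [a i] and [b i] such
    that [a i] commutes with [b j] exactly when [i <> j]. A compact metric space
    is Hausdorff and has a countable basis, and on such a space no uncountable
    index set carries families like these ([countable_diagonal_noncommuting]).
    The idea is that the centraliser of [a i] is closed for pointwise
    convergence, so that no [b i] is a pointwise limit of the other [b j]: the
    [b i] form a discrete family. The basis turns discreteness into
    countability: the failure of [a i] and [b i] to commute at one point is
    witnessed by four basic open sets, and two distinct indices cannot have the
    same four witnesses. *)

(** Separate [a (b p)] from [b (a p)] and pull the two open sets back by
    continuity. The point of the conclusion is that it constrains [b] only
    through [P], [Q], [U] and [W]: any other map [c] with [c p] in [U] and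
    [c (a p)] in [W] satisfies [a (c p) <> c (a p)] as well. *)
Lemma noncommuting_basic_witness (X : topologicalType) (B : set (set X))
    (a b : X -> X) (p : X) :
  hausdorff_space X -> basis B -> continuous a -> continuous b ->
  a (b p) <> b (a p) ->
  exists P Q U W : set X, [/\ B P, B Q, B U & B W] /\
    [/\ P p, Q (a p), (forall x, P x -> U (b x)), (forall x, Q x -> W (b x)) &
      (forall u, U u -> ~ W (a u))].
Proof.
move=> hX [Bo Bn] ca cb /eqP; move: hX; rewrite open_hausdorff => /[apply].
case=> -[A V] /= [/set_mem Aab /set_mem Vba] [oA oV /eqP AV0].
have basic_sub x N : nbhs x N -> filter_from [set U | B U /\ U x] id N.
  exact: (Bn x N).
have [U [BU Ubp] UA] :=
  basic_sub (b p) _ (ca _ _ (open_nbhs_nbhs (conj oA Aab))).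
have [W [BW Wq] WV] := basic_sub _ _ (open_nbhs_nbhs (conj oV Vba)).
have basic_nbhs D x : B D -> D x -> nbhs x D.
  by move=> BD Dx; apply: open_nbhs_nbhs; split=> //; exact: Bo.
have [P [BP Pp] PU] := basic_sub p _ (cb _ _ (basic_nbhs _ _ BU Ubp)).
have [Q [BQ Qp] QW] := basic_sub (a p) _ (cb _ _ (basic_nbhs _ _ BW Wq)).
exists P, Q, U, W; split=> //; split=> // u Uu Wau.
have : (A `&` V) (a u) by split; [exact: UA | exact: WV].
by rewrite AV0.
Qed.

(** The four witnesses determine the index: if [i] and [j] shared them, the two
    inclusions satisfied by [b j] would make it fail to commute with [a i].
    Since the witnesses range over quadruples of basic sets, there are countably
    many indices. *)
Lemma countable_diagonal_noncommuting (X : topologicalType) (I : Type)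
    (a b : I -> X -> X) :
  hausdorff_space X -> @second_countable X ->
  (forall i, continuous (a i)) -> (forall i, continuous (b i)) ->
  (forall i j x, i <> j -> a i (b j x) = b j (a i x)) ->
  (forall i, exists x, a i (b i x) <> b i (a i x)) ->
  countable [set: I].
Proof.
move=> hX [B /countable_injP[e einj] basisB] ca cb comm ncomm.
pose witness i (F : set X * set X * set X * set X) :=
  let: (P, Q, U, W) := F in [/\ B P, B Q, B U & B W] /\
  exists p, [/\ P p, Q (a i p), (forall x, P x -> U (b i x)),
    (forall x, Q x -> W (b i x)) & (forall u, U u -> ~ W (a i u))].
have /choice[F FP] i : exists F, witness i F.
  have [p np] := ncomm i.
  have [P [Q [U [W [BF wF]]]]] :=
    noncommuting_basic_witness _ _ _ _ _ hX basisB (ca i) (cb i) np.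
  by exists (P, Q, U, W); split=> //; exists p.
pose code i := let: (P, Q, U, W) := F i in (e P, e Q, e U, e W).
apply/countable_injP; exists (choice.pickle \o code) => i j _ _.
move=> /(pcan_inj choice.pickleK); rewrite /code.
move: (FP i) (FP j); case: (F i) (F j) => [[[P Q] U] W] [[[P' Q'] U'] W'].
move=> [[BP BQ BU BW] [p [Pp Qp _ _ UW]]] [[BP' BQ' BU' BW'] [_ [_ _ PU QW _]]].
move=> [/einj-/(_ (mem_set BP) (mem_set BP')) eP
        /einj-/(_ (mem_set BQ) (mem_set BQ')) eQ
        /einj-/(_ (mem_set BU) (mem_set BU')) eU
        /einj-/(_ (mem_set BW) (mem_set BW')) eW].
subst P' Q' U' W'; apply: contrapT => ij.
by apply: (UW (b j p)); [exact: PU | rewrite comm //; exact: QW].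
Qed.

(** [compact_second_countable] asks for a pointed space; the empty space
    has the empty basis. *)
Lemma compact_metric_second_countable (R : realType) (X : metricType R) :
  compact [set: X] -> @second_countable X.
Proof.
move=> cX; have [[x0 _]|X0] := pselect (exists x : X, True).
  pose pointX := isPointed.Build X x0.
  pose Y : pseudoPMetricType R := HB.pack X pointX.
  exact: (@compact_second_countable R Y cX).
exists set0; first exact: countable0.
by split=> [U //|x]; exfalso; apply: X0; exists x.
Qed.

Section Coordinate.
Context {I : Type} {G : I -> groupType}.
Implicit Types x y : direct_product G.

(** Cutting a whole family [x] down to its coordinate [i], instead of inserting
    an element of [G i] in a trivial family, avoids transport along
    equalities of indices. *)
Definition coordinate_part x i : direct_product G :=
  fun j => if `[< j = i >] then x j else 1.

Lemma coordinate_part_finite x i : finitely_supported (coordinate_part x i).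
Proof.
apply/asboolP; apply: (sub_finite_set _ (finite_set1 i)) => j /=.
by rewrite /coordinate_part; case: asboolP.
Qed.

Definition coordinate x i : direct_sum G :=
  DirectSum (coordinate_part_finite x i).

Lemma coordinate_commute x y i j :
  i <> j -> commute (coordinate x i) (coordinate y j).
Proof.
move=> ij; apply: val_inj; apply: functional_extensionality_dep => k.
change (coordinate_part x i k * coordinate_part y j k
      = coordinate_part y j k * coordinate_part x i k).
rewrite /coordinate_part; case: asboolP => [ki|_]; last by rewrite mul1g mulg1.
by case: asboolP => [kj|_]; [rewrite -ki -kj in ij | rewrite mul1g mulg1].
Qed.

Lemma commute_coordinate x y i :
  commute (coordinate x i) (coordinate y i) -> commute (x i) (y i).
Proof.
move=> /(congr1 (fun f : direct_sum G => direct_sum_val f i)) xyi.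
change (coordinate_part x i i * coordinate_part y i i
      = coordinate_part y i i * coordinate_part x i i) in xyi.
by move: xyi; rewrite /coordinate_part; case: asboolP.
Qed.

End Coordinate.

Theorem theorem1 (R : realType) (X : metricType R) (hX : compact [set: X])
    (I : Type) (hI : ~ countable [set: I])
    (G : I -> groupType)
    (hG : forall i : I, exists x y : G i, ~ commute x y) :
  ~ exists phi : {multiplicative direct_sum G -> homeo X}, injective phi.
Proof.
move=> [phi phi_inj]; apply: hI.
pose x : direct_product G := fun i => projT1 (cid (hG i)).
have hx i : exists y, ~ commute (x i) y := projT2 (cid (hG i)).
pose y : direct_product G := fun i => projT1 (cid (hx i)).
have xy i : ~ commute (x i) (y i) := projT2 (cid (hx i)).
apply: (@countable_diagonal_noncommuting X I
  (fun i => phi (coordinate x i)) (fun i => phi (coordinate y i))).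
- exact: metric_hausdorff.
- exact: compact_metric_second_countable.
- by move=> i; exact: homeo_fun_continuous.
- by move=> i; exact: homeo_fun_continuous.
- move=> i j p ij; have /(congr1 phi) := coordinate_commute x y i j ij.
  by rewrite !gmulfM => /(congr1 (fun h : homeo X => h p)).
move=> i; apply: contrapT => /forallNP commp.
apply: (xy i); apply: commute_coordinate; apply: phi_inj; rewrite !gmulfM.
by apply: homeo_eqP => p; exact: contrapT (commp p).
Qed.
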